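(* Let $k$ be a field of characteristic zero, let $B=k[X_{1},\ldots,X_{n}]/I=k[x_{1},\ldots,x_{n}]$ be a finitely generated $k$-domain such that $I\subset(X_1,\ldots,X_n)$, and let $\partial\in\mathrm{LND}(B)$ have kernel $\ker\partial$ finitely generated as a $k$-algebra. Let $\ker\partial$ be generated over $k$ by $z_i(x_1,\ldots,x_n)$, $i=1,\ldots,r$, where $z_i\in k[X_1,\ldots,X_n]$ and $z_i(0,\ldots,0)=0$. Let $s_i=s_i(x_1,\ldots,x_n)\in\ker\partial^2$, $i=1,\ldots,m$, where $s_i\in k[X_1,\ldots,X_n]$ and $s_i(0,\ldots,0)=0$, be such that $\partial(s_1),\ldots,\partial(s_m)$ generate the plinth ideal $\mathrm{pl}(\partial)$, so that $\ker\partial^2=(\ker\partial)s_1+\cdots+(\ker\partial)s_m+\ker\partial$. Let $d_i=\deg_\partial(x_i)$ (with all $x_i\neq0$), and let $\mathcal{G}=\{\mathcal{G}_i\}_{i\in\mathbb{N}}$ be the $\mathbb{N}$-filtration of $B$ given by $$\mathcal{G}_i=\sum_{j\le i}\ \sum_{u_1+\cdots+u_m+d_1v_1+\cdots+d_nv_n=j}(\ker\partial)\, s_1^{u_1}\cdots s_m^{u_m}x_1^{v_1}\cdots x_n^{v_n}\quad(u_a,v_b\in\mathbb{N}).$$ Let $k^{[r+n+m]}=k[Z_1,\ldots,Z_r,X_1,\ldots,X_n,S_1,\ldots,S_m]$, let $J$ be the ideal of $k^{[r+n+m]}$ generated by $I$, the elements $Z_i-z_i(X_1,\ldots,X_n)$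 ($1\le i\le r$) and the elements $S_i-s_i(X_1,\ldots,X_n)$ ($1\le i\le m$), let $\omega$ be the weighted degree on $k^{[r+n+m]}$ with $\omega(Z_i)=0$, $\omega(S_i)=1$, $\omega(X_i)=d_i$, and let $\hat J$ be the ideal generated by the highest $\omega$-homogeneous components of all elements of $J$. If $\mathcal{G}$ is proper, then $\mathrm{Gr}_\partial(B)\simeq k^{[r+n+m]}/\hat J$.
   Context: $\mathbb{N}=\mathbb{Z}_{\ge 0}$. A $k$-derivation $\partial$ of $B$ is locally nilpotent if for every $a\in B$ there is $N$ with $\partial^N(a)=0$; $\mathrm{LND}(B)$ is the set of these. The plinth ideal is $\mathrm{pl}(\partial)=\ker\partial\cap\partial(B)$, an ideal of $\ker\partial$. For $a\ne 0$, $\deg_\partial(a)=\min\{i\in\mathbb{N}\mid\partial^{i+1}(a)=0\}$, and $\deg_\partial(0)=-\infty$. The $\partial$-filtration is $\mathcal{F}_i=\ker\partial^{i+1}$, $i\in\mathbb{N}$, with $\mathcal{F}_{-1}=\{0\}$, and $\mathrm{Gr}_\partial(B)=\bigoplus_{i\in\mathbb{N}}\mathcal{F}_i/\mathcal{F}_{i-1}$ is its associated graded $k$-algebra, with product $(a+\mathcal{F}_{i-1})(b+\mathcal{F}_{j-1})=ab+\mathcal{F}_{i+j-1}$. An $\mathbb{N}$-filtration of $B$ is a family $\{\mathcal{G}_i\}_{i\in\mathbb{N}}$ of $k$-subspaces with $\mathcal{G}_i\subset\mathcal{G}_{i+1}$, $B=\bigcup_i\mathcal{G}_i$, and $\mathcal{G}_i\mathcal{G}_j\subset\mathcal{G}_{i+j}$.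 It is proper if, in addition, $a\in\mathcal{G}_i\setminus\mathcal{G}_{i-1}$ and $b\in\mathcal{G}_j\setminus\mathcal{G}_{j-1}$ imply $ab\in\mathcal{G}_{i+j}\setminus\mathcal{G}_{i+j-1}$ (with $\mathcal{G}_{-1}=\{0\}$). The weighted degree $\omega$ of a non-zero polynomial is the maximum of the weights of its monomials; the highest homogeneous component of a polynomial is the sum of its terms of maximal weight. The symbol $\simeq$ denotes isomorphism of $k$-algebras. *)

(* Defs.v *)
From HB Require Import structures.
From mathcomp Require Import all_boot all_order all_algebra ring_quotient.
From mathcomp Require Import boolp.
From mathcomp Require Import mpoly.

Set Implicit Arguments.
Unset Strict Implicit.
Unset Printing Implicit Defensive.

Import GRing.Theory.

Local Open Scope ring_scope.
Local Open Scope quotient_scope.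

(* Unlike [idealr], not required to be proper. *)
Record ideal (R : comPzRingType) := Ideal {
  ideal_mem :> {pred R};
  ideal_zmod : zmod_closed ideal_mem;
  ideal_absorb : forall a u : R, u \in ideal_mem -> a * u \in ideal_mem
}.

HB.instance Definition _ (R : comPzRingType) (I : ideal R) :=
  GRing.isZmodClosed.Build R (ideal_mem I) (ideal_zmod I).

Section GeneratedIdeal.
Variables (R : comPzRingType) (S : R -> Prop).

Definition in_span (a : R) : Prop :=
  exists l : seq (R * R),
    (forall t, t \in l -> S t.2) /\ a = \sum_(t <- l) t.1 * t.2.

Lemma in_spanM a u : in_span u -> in_span (a * u).
Proof.
move=> [l [Sl ->]]; exists [seq (a * t.1, t.2) | t <- l]; split.
  by move=> t /mapP[t' /Sl St' ->].
by rewrite big_map mulr_sumr; apply: eq_bigr => t _; rewrite mulrA.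
Qed.

Definition span_pred : {pred R} := fun a => `[< in_span a >].

Lemma in_span_zmod : zmod_closed span_pred.
Proof.
split; first by apply/asboolP; exists [::]; rewrite big_nil.
move=> u v /asboolP[l [Sl ->]] /asboolP/(in_spanM (-1)) [l' [Sl' def_v]].
apply/asboolP; exists (l ++ l'); split.
  by move=> t; rewrite mem_cat => /orP[/Sl|/Sl'].
by rewrite big_cat /= -def_v mulN1r.
Qed.

Lemma in_span_absorb a u : u \in span_pred -> a * u \in span_pred.
Proof. by move=> /asboolP Su; apply/asboolP; exact: in_spanM. Qed.

Definition ideal_span : ideal R := Ideal in_span_zmod in_span_absorb.

End GeneratedIdeal.

(* MathComp's algebra structures exclude the zero ring, which A/I may be; the
   quotient carries the structures [comPzRingType] and [lmodType k], compatible
   by [qscaleAl]. *)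
Definition quot_alg (k : pzRingType) (A : comAlgType k) (I : ideal A) : Type :=
  Quotient.quot (ideal_mem I).

Section QuotientAlgebra.
Variables (k : pzRingType) (A : comAlgType k) (I : ideal A).

HB.instance Definition _ := GRing.Zmodule.on (quot_alg I).

Definition qclass (a : A) : quot_alg I := \pi_(Quotient.quot (ideal_mem I)) a.

Lemma qclassP u v : reflect (qclass u = qclass v) (u - v \in ideal_mem I).
Proof. by rewrite Quotient.idealrBE; apply: eqP. Qed.

Lemma qclassB : {morph qclass : u v / u - v}.
Proof. exact: (raddfB (\pi_(Quotient.quot (ideal_mem I)))). Qed.

Lemma qclassD : {morph qclass : u v / u + v}.
Proof. exact: (raddfD (\pi_(Quotient.quot (ideal_mem I)))). Qed.

Lemma qclass0 : qclass 0 = 0.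
Proof. exact: (raddf0 (\pi_(Quotient.quot (ideal_mem I)))). Qed.

Lemma qclass_sum (N : nat) (f : 'I_N -> A) :
  qclass (\sum_i f i) = \sum_i qclass (f i).
Proof. exact: (raddf_sum (\pi_(Quotient.quot (ideal_mem I)))). Qed.

Definition qrepr (q : quot_alg I) : A :=
  repr (q : Quotient.quot (ideal_mem I)).

Lemma qreprK : cancel qrepr qclass.
Proof. by move=> q; rewrite /qclass reprK. Qed.

Definition qone : quot_alg I := qclass 1.
Definition qmul (p q : quot_alg I) : quot_alg I := qclass (qrepr p * qrepr q).
Definition qscale (c : k) (q : quot_alg I) : quot_alg I := qclass (c *: qrepr q).

Lemma qclassM_eq u v u' v' : qclass u = qclass u' -> qclass v = qclass v' ->
  qclass (u * v) = qclass (u' * v').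
Proof.
move=> /qclassP uu' /qclassP vv'; apply/qclassP.
have ->: u * v - u' * v' = v * (u - u') + u' * (v - v').
  by rewrite !mulrBr addrA (mulrC v u) (mulrC v u') subrK.
by apply: rpredD; apply: ideal_absorb.
Qed.

Lemma qclassM u v : qclass (u * v) = qmul (qclass u) (qclass v).
Proof. by apply: qclassM_eq; rewrite qreprK. Qed.

Lemma qclassZ c u : qclass (c *: u) = qscale c (qclass u).
Proof.
rewrite /qscale -[u in LHS]mul1r -[qrepr _ in RHS]mul1r !scalerAl.
by apply: qclassM_eq; rewrite ?qreprK.
Qed.

Lemma qmulA : associative qmul.
Proof.
by move=> p q s; rewrite -[p]qreprK -[q]qreprK -[s]qreprK -!qclassM mulrA.
Qed.

Lemma qmulC : commutative qmul.
Proof. by move=> p q; rewrite -[p]qreprK -[q]qreprK -!qclassM mulrC. Qed.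

Lemma qmul1 : left_id qone qmul.
Proof. by move=> p; rewrite -[p]qreprK -!qclassM mul1r. Qed.

Lemma qmulDl : left_distributive qmul +%R.
Proof.
move=> p q s; rewrite -[p]qreprK -[q]qreprK -[s]qreprK.
by rewrite -qclassD -!qclassM -qclassD mulrDl.
Qed.

Lemma qmul0 : left_zero 0 qmul.
Proof. by move=> p; rewrite -[p]qreprK -qclass0 -qclassM mul0r. Qed.

HB.instance Definition _ := GRing.Zmodule_isComPzRing.Build (quot_alg I)
  qmulA qmulC qmul1 qmulDl.

Lemma qscaleA a b q : qscale a (qscale b q) = qscale (a * b) q.
Proof. by rewrite -[q]qreprK -!qclassZ scalerA. Qed.

Lemma qscale1 : left_id 1 qscale.
Proof. by move=> q; rewrite -[q]qreprK -!qclassZ scale1r. Qed.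

Lemma qscaleDr : right_distributive qscale +%R.
Proof.
move=> a p q; rewrite -[p]qreprK -[q]qreprK.
by rewrite -qclassD -!qclassZ -qclassD scalerDr.
Qed.

Lemma qscaleDl q : {morph qscale^~ q : a b / a + b}.
Proof. by move=> a b; rewrite -[q]qreprK -!qclassZ -qclassD scalerDl. Qed.

HB.instance Definition _ := GRing.Zmodule_isLmodule.Build k (quot_alg I)
  qscaleA qscale1 qscaleDr qscaleDl.

Lemma qscaleAl (c : k) (p q : quot_alg I) : c *: (p * q) = (c *: p) * q.
Proof.
rewrite -[p]qreprK -[q]qreprK /GRing.scale /GRing.mul /=.
by rewrite -qclassM -!qclassZ -qclassM scalerAl.
Qed.

End QuotientAlgebra.

Record lnd (k : fieldType) (B : comAlgType k) := Lnd {
  lnd_fun :> {linear B -> B};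
  lnd_leibniz : forall a b : B, lnd_fun (a * b) = lnd_fun a * b + a * lnd_fun b;
  lnd_nilpotent : forall a : B, exists N : nat, iter N lnd_fun a = 0
}.

Section LocallyNilpotent.
Variables (k : fieldType) (B : comAlgType k) (D : lnd B).

Definition plinth (a : B) : Prop := D a = 0 /\ exists b, a = D b.

Lemma lnd_iter0 i : iter i D 0 = 0.
Proof. by elim: i => //= i ->; rewrite raddf0. Qed.

Lemma lnd_iterB i : {morph iter i D : a b / a - b}.
Proof. by move=> a b; elim: i => //= i ->; rewrite raddfB. Qed.

Lemma lnd_iterD i : {morph iter i D : a b / a + b}.
Proof. by move=> a b; elim: i => //= i ->; rewrite raddfD. Qed.

Lemma lnd_iterZ i c : {morph iter i D : a / c *: a}.
Proof. by move=> a; elim: i => //= i ->; rewrite linearZ. Qed.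

Lemma lnd_iter_le i j a : (i <= j)%N -> iter i D a = 0 -> iter j D a = 0.
Proof. by move=> /subnK <- Da; rewrite iterD Da lnd_iter0. Qed.

Lemma lnd_deg_ex a : exists i, iter i.+1 D a == 0.
Proof. by have [N DN] := lnd_nilpotent D a; exists N; rewrite /= DN raddf0. Qed.

(* [None] stands for -oo. *)
Definition lnd_deg (a : B) : option nat :=
  if a == 0 then None else Some (ex_minn (lnd_deg_ex a)).

Lemma lnd_iterM i j a b :
  iter i D a = 0 -> iter j D b = 0 -> iter (i + j).-1 D (a * b) = 0.
Proof.
have [N] := ubnP (i + j); elim: N i j a b => // N IH [|i] [|j] a b ltN.
- by move=> /= -> _; rewrite mul0r ?lnd_iter0.
- by move=> /= -> _; rewrite mul0r ?lnd_iter0.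
- by move=> _ /= ->; rewrite mulr0 ?lnd_iter0.
move=> Da Db; have -> : ((i.+1 + j.+1).-1 = (i + j).+1)%N by rewrite addnS.
rewrite iterSr lnd_leibniz lnd_iterD.
have lt_ijN : (i + j.+1 < N)%N by rewrite -ltnS -addSn.
have -> : iter (i + j) D (D a * b) = 0.
  by have := IH i j.+1 (D a) b lt_ijN; rewrite -iterSr addnS; apply.
have lt_jiN : (i.+1 + j < N)%N by rewrite addSnnS.
by have := IH i.+1 j a (D b) lt_jiN; rewrite -iterSr addSn add0r; apply.
Qed.

(* The polynomial sum_i a_i T^i over B with a_i in F_i encodes the family
   (a_i) in the direct sum of the F_i; these families form a k-algebra for
   the product of B[T], and quotienting by the direct sum of the F_(i-1) gives
   Gr_D(B).  Since ker D^0 = 0, the convention F_(-1) = 0 is built in. *)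
Definition fam_pred : {pred {poly B}} :=
  fun p : {poly B} => [forall i : 'I_(size p), iter i.+1 D p`_i == 0].

Lemma fam_predP (p : {poly B}) : reflect (forall i, iter i.+1 D p`_i = 0) (p \in fam_pred).
Proof.
apply: (iffP forallP) => [Fp i | Fp i]; last exact/eqP.
have [lt_i | le_i] := ltnP i (size p); first exact/eqP/(Fp (Ordinal lt_i)).
by rewrite nth_default // lnd_iter0.
Qed.

Lemma lnd1 : D 1 = 0.
Proof.
have /eqP := lnd_leibniz D 1 1; rewrite !mul1r mulr1.
by rewrite -subr_eq0 opprD addrA subrr sub0r oppr_eq0 => /eqP.
Qed.

Lemma lnd_alg c : D c%:A = 0.
Proof. by rewrite linearZ /= lnd1 scaler0. Qed.

Lemma fam_subring : subring_closed fam_pred.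
Proof.
split.
- apply/fam_predP => i; rewrite coef1; case: i => [|i]; first exact: lnd1.
  exact: lnd_iter0.
- move=> p q /fam_predP Fp /fam_predP Fq; apply/fam_predP => i.
  by rewrite coefB lnd_iterB Fp Fq subr0.
move=> p q /fam_predP Fp /fam_predP Fq; apply/fam_predP => i.
rewrite coefM; elim/big_rec: _ => [|j y _ IH]; first exact: lnd_iter0.
rewrite lnd_iterD IH addr0.
have := lnd_iterM (Fp j) (Fq (i - j)%N).
by rewrite addSn addnS /= subnKC // -ltnS.
Qed.

HB.instance Definition _ := GRing.isSubringClosed.Build {poly B} fam_pred
  fam_subring.

Record fam := Fam { fam_poly :> {poly B}; fam_polyP : fam_poly \in fam_pred }.

HB.instance Definition _ := [isSub for fam_poly].
HB.instance Definition _ := [Choice of fam by <:].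
HB.instance Definition _ := [SubChoice_isSubComNzRing of fam by <:].

Lemma fam_poly_sum N (f : 'I_N -> fam) :
  fam_poly (\sum_i f i) = \sum_i fam_poly (f i).
Proof. exact: (big_morph fam_poly). Qed.

Lemma fam_scale_subproof (c : k) (p : fam) : c%:A%:P * fam_poly p \in fam_pred.
Proof.
have /fam_predP Fp := fam_polyP p; apply/fam_predP => i.
by rewrite coefCM -scalerAl mul1r lnd_iterZ Fp scaler0.
Qed.

Definition fam_scale (c : k) (p : fam) : fam := Fam (fam_scale_subproof c p).

Lemma fam_scaleA a b p : fam_scale a (fam_scale b p) = fam_scale (a * b) p.
Proof.
apply: val_inj => /=; rewrite mulrA -polyCM; congr (_%:P * _).
by rewrite -scalerAl mul1r scalerA.
Qed.

Lemma fam_scale1 : left_id 1 fam_scale.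
Proof. by move=> p; apply: val_inj; rewrite /= scale1r mul1r. Qed.

Lemma fam_scaleDr : right_distributive fam_scale +%R.
Proof. by move=> a p q; apply: val_inj; rewrite /= mulrDr. Qed.

Lemma fam_scaleDl p : {morph fam_scale^~ p : a b / a + b}.
Proof.
by move=> a b; apply: val_inj; rewrite /= scalerDl polyCD mulrDl.
Qed.

HB.instance Definition _ := GRing.Zmodule_isLmodule.Build k fam
  fam_scaleA fam_scale1 fam_scaleDr fam_scaleDl.

Lemma fam_scaleAl (c : k) (p q : fam) : c *: (p * q) = (c *: p) * q.
Proof. by apply: val_inj; rewrite /= mulrA. Qed.

HB.instance Definition _ := GRing.Lmodule_isLalgebra.Build k fam fam_scaleAl.

HB.instance Definition _ := GRing.Lalgebra_isComAlgebra.Build k fam.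

Definition low_pred : {pred fam} :=
  fun p => [forall i : 'I_(size (fam_poly p)), iter i D (fam_poly p)`_i == 0].

Lemma low_predP (p : fam) :
  reflect (forall i, iter i D (fam_poly p)`_i = 0) (p \in low_pred).
Proof.
apply: (iffP forallP) => [Fp i | Fp i]; last exact/eqP.
have [lt_i | le_i] := ltnP i (size (fam_poly p)).
  exact/eqP/(Fp (Ordinal lt_i)).
by rewrite nth_default // lnd_iter0.
Qed.

Lemma low_zmod : zmod_closed low_pred.
Proof.
split; first by apply/low_predP => i; rewrite /= coef0 lnd_iter0.
move=> p q /low_predP Fp /low_predP Fq; apply/low_predP => i.
by rewrite /= coefB lnd_iterB Fp Fq subr0.
Qed.

Lemma low_absorb (p q : fam) : q \in low_pred -> p * q \in low_pred.
Proof.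
move=> /low_predP Fq; have /fam_predP Fp := fam_polyP p; apply/low_predP => i.
rewrite /= coefM; elim/big_rec: _ => [|j y _ IH]; first exact: lnd_iter0.
rewrite lnd_iterD IH addr0.
by have := lnd_iterM (Fp j) (Fq (i - j)%N); rewrite addSn /= subnKC // -ltnS.
Qed.

Definition low_ideal : ideal fam := Ideal low_zmod low_absorb.

Definition gr_alg : Type := quot_alg low_ideal.

HB.instance Definition _ := GRing.ComPzRing.on gr_alg.
HB.instance Definition _ := GRing.Lmodule.on gr_alg.

(* [gr_class i Fa] is a + F_(i-1); the lemmas below check that [gr_alg] is the
   direct sum of the F_i / F_(i-1) with the expected operations. *)
Lemma gr_class_subproof i (a : B) (Fa : iter i.+1 D a = 0) :
  a *: 'X^i \in fam_pred.
Proof.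
apply/fam_predP => j; rewrite coefZ coefXn; case: eqP => [->|_].
  by rewrite mulr1.
by rewrite mulr0 lnd_iter0.
Qed.

Definition gr_class i (a : B) (Fa : iter i.+1 D a = 0) : gr_alg :=
  qclass low_ideal (Fam (gr_class_subproof Fa)).

Lemma gr_class_eq i a b (Fa : iter i.+1 D a = 0) (Fb : iter i.+1 D b = 0) :
  gr_class Fa = gr_class Fb <-> iter i D (a - b) = 0.
Proof.
split=> [/qclassP/low_predP/(_ i) | Fab].
  by rewrite /= coefB !coefZ coefXn eqxx !mulr1.
apply/qclassP/low_predP => j; rewrite /= coefB !coefZ coefXn.
by case: eqP => [->|_]; rewrite ?mulr1 // !mulr0 subr0 lnd_iter0.
Qed.

Lemma gr_alg0 : 0 = qclass low_ideal 0 :> gr_alg.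
Proof. exact: esym (qclass0 low_ideal). Qed.

Lemma gr_class_linear i c a b (Fa : iter i.+1 D a = 0) (Fb : iter i.+1 D b = 0)
    (Fab : iter i.+1 D (c *: a + b) = 0) :
  gr_class Fab = c *: gr_class Fa + gr_class Fb.
Proof.
transitivity (qclass low_ideal
    (c *: Fam (gr_class_subproof Fa) + Fam (gr_class_subproof Fb))).
  congr (qclass _ _); apply: val_inj => /=.
  by rewrite scalerDl -!mul_polyC mulrA -polyCM -scalerAl mul1r.
by rewrite qclassD qclassZ.
Qed.

Lemma gr_classM i j a b (Fa : iter i.+1 D a = 0) (Fb : iter j.+1 D b = 0)
    (Fab : iter (i + j).+1 D (a * b) = 0) :
  gr_class Fab = gr_class Fa * gr_class Fb.
Proof.
transitivity (qclass low_ideal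
    (Fam (gr_class_subproof Fa) * Fam (gr_class_subproof Fb))).
  congr (qclass _ _); apply: val_inj => /=.
  by rewrite exprD -!mul_polyC polyCM mulrACA.
by rewrite qclassM.
Qed.

Lemma gr_class1 (F1 : iter 1 D 1 = 0) : gr_class F1 = 1.
Proof.
by congr (qclass _ _); apply: val_inj; rewrite /= expr0 scale1r.
Qed.

Lemma gr_class_decomp (q : gr_alg) :
  exists N (a : 'I_N -> B) (Fa : forall i : 'I_N, iter i.+1 D (a i) = 0),
    q = \sum_i gr_class (Fa i).
Proof.
pose p := qrepr q; have /fam_predP Fp := fam_polyP p.
exists (size (fam_poly p)), (fun i => (fam_poly p)`_i), (fun i => Fp i).
rewrite -[LHS]qreprK -/p /gr_class.
rewrite -qclass_sum; congr (qclass _ _); apply: val_inj.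
rewrite [RHS]fam_poly_sum /=.
by rewrite -[LHS]coefK poly_def.
Qed.

Lemma gr_class_direct N (a : 'I_N -> B)
    (Fa : forall i : 'I_N, iter i.+1 D (a i) = 0) :
  \sum_i gr_class (Fa i) = 0 -> forall i, gr_class (Fa i) = 0.
Proof.
move=> eq0 i; apply: etrans (esym gr_alg0).
have /qclassP/low_predP low : qclass low_ideal
    (\sum_i Fam (gr_class_subproof (Fa i))) = qclass low_ideal 0.
  by rewrite qclass_sum; exact: etrans eq0 gr_alg0.
apply/qclassP/low_predP => j; move: (low j).
rewrite !subr0 fam_poly_sum /= coef_sum coefZ coefXn.
case: eqP => [->|_ _]; last by rewrite mulr0 lnd_iter0.
rewrite (bigD1 i) //= big1 => [|l]; first by rewrite addr0 coefZ coefXn eqxx.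
by rewrite coefZ coefXn eq_sym -val_eqE => /negPf ->; rewrite mulr0.
Qed.

End LocallyNilpotent.

Section Filtrations.
Variables (k : fieldType) (B : comAlgType k).
Implicit Type G : nat -> B -> Prop.

Definition is_subspace (V : B -> Prop) : Prop :=
  V 0 /\ forall (c : k) a b, V a -> V b -> V (c *: a + b).

Definition nfiltration G : Prop :=
  [/\ forall i, is_subspace (G i),
      forall i a, G i a -> G i.+1 a,
      forall a, exists i, G i a
    & forall i j a b, G i a -> G j b -> G (i + j)%N (a * b)].

(* a is in G_i but not in G_(i-1), where G_(-1) = 0. *)
Definition exact_level G i (a : B) : Prop :=
  G i a /\ ~ (if i is j.+1 then G j a else a = 0).

Definition proper_nfiltration G : Prop :=
  nfiltration G /\
  forall i j a b, exact_level G i a -> exact_level G j b ->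
    exact_level G (i + j)%N (a * b).

(* In a term t of l: t.1 is the coefficient, t.2.1 and t.2.2 the exponents of
   the s_j and of the x_i. *)
Definition gen_filtration (D : lnd B) (m n : nat) (s : 'I_m -> B)
    (x : 'I_n -> B) (d : 'I_n -> nat) (i : nat) (a : B) : Prop :=
  exists l : seq (B * ('X_{1..m} * 'X_{1..n})),
    (forall t, t \in l -> D t.1 = 0 /\
       (\sum_(e < m) t.2.1 e + \sum_(e < n) d e * t.2.2 e <= i)%N) /\
    a = \sum_(t <- l)
          t.1 * (\prod_(e < m) s e ^+ t.2.1 e) * (\prod_(e < n) x e ^+ t.2.2 e).

End Filtrations.

Definition alg_eval (k : fieldType) (B : comAlgType k) (n : nat)
    (x : 'I_n -> B) (p : {mpoly k[n]}) : B :=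
  mmap (in_alg B) x p.

Section WeightedDegree.
Variables (k : fieldType) (N : nat) (w : 'I_N -> nat).

Definition mweightw (mu : 'X_{1..N}) : nat := \sum_(i < N) w i * mu i.

(* 0 if p = 0 *)
Definition wdegree (p : {mpoly k[N]}) : nat :=
  \max_(mu <- msupp p) mweightw mu.

Definition top_component (p : {mpoly k[N]}) : {mpoly k[N]} :=
  \sum_(mu <- msupp p | mweightw mu == wdegree p) p@_mu *: 'X_[mu].

End WeightedDegree.

Section Presentation.
Variables (k : fieldType) (r n m : nat).

Definition varZ (i : 'I_r) : {mpoly k[r + n + m]} := 'X_(lshift m (lshift n i)).
Definition varX (i : 'I_n) : {mpoly k[r + n + m]} := 'X_(lshift m (rshift r i)).
Definition varS (i : 'I_m) : {mpoly k[r + n + m]} := 'X_(rshift (r + n) i).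

Definition inX (p : {mpoly k[n]}) : {mpoly k[r + n + m]} :=
  p \mPo [tuple varX i | i < n].

Definition omega (d : 'I_n -> nat) (i : 'I_(r + n + m)) : nat :=
  match split i with
  | inl j => match split j with inl _ => 0%N | inr b => d b end
  | inr _ => 1%N
  end.

Variables (I : ideal {mpoly k[n]}) (z : 'I_r -> {mpoly k[n]})
  (s : 'I_m -> {mpoly k[n]}).

Definition idealJ : ideal {mpoly k[r + n + m]} :=
  ideal_span (fun q =>
    [\/ exists2 p, p \in I & q = inX p,
        exists i, q = varZ i - inX (z i)
      | exists i, q = varS i - inX (s i)]).

Definition hatJ (d : 'I_n -> nat) : ideal {mpoly k[r + n + m]} :=
  ideal_span (fun q =>
    exists2 p, p \in idealJ & q = top_component (omega d) p).

End Presentation.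

(* Main.v *)
(* Since G is proper, G_i = ker D^(i+1): for a of degree i+1 and t = D^i a, the
   element (i+1)! D(t)^i a - t^(i+1) has smaller degree, so by induction some
   nonzero multiple c a with c in ker D = G_0 lies in the expected G_i, and
   properness lets one cancel c.  Evaluating the variables of k^[r+n+m] at the
   classes of the z_i, x_i, s_i in their respective degrees then gives a
   surjection onto Gr_D(B): a polynomial of weight i goes to the class of its
   value in F_i / F_(i-1).  A homogeneous q of weight i is in its kernel iff the
   value of q is that of some h of weight less than i, i.e. iff q is the highest
   component of an element q - h of J (or zero). *)
From HB Require Import structures.
Require Import Defs.
From mathcomp Require Import all_boot all_order all_algebra.
From mathcomp Require Import boolp mpoly.

Set Implicit Arguments.
Unset Strict Implicit.
Unset Printing Implicit Defensive.

Import GRing.Theory.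
Local Open Scope ring_scope.

(** * Isomorphisms of quotients *)

(** First isomorphism theorem, stated for the inverse map: [f] picks a preimage under [Psi] modulo
    [L]. Since [Psi] induces an injection of the quotients, every identity for [f] can be checked
    after applying [Psi]. *)
Lemma quot_iso (k : pzRingType) (A C : comAlgType k) (I : ideal A) (L : ideal C)
    (Psi : A -> C) (PsiM : monoid_morphism Psi) (PsiL : linear Psi)
    (Psi_surj : forall y, exists p, y - Psi p \in L)
    (Psi_ker : forall p, p \in I <-> Psi p \in L) :
  exists f : quot_alg L -> quot_alg I,
    [/\ bijective f, linear f & monoid_morphism f].
Proof.
have PsiB : {morph Psi : u v / u - v}.
  by move=> u v; rewrite -![_ - v]addrC -scaleN1r PsiL scaleN1r addrC.
have PsiE u v : qclass I u = qclass I v <-> qclass L (Psi u) = qclass L (Psi v).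
  split=> [/qclassP/Psi_ker|/qclassP]; rewrite ?PsiB; first by move/qclassP.
  by rewrite -PsiB => /Psi_ker/qclassP.
have /choice[g gP] (y : quot_alg L) : exists p, y = qclass L (Psi p).
  by have [p /qclassP yp] := Psi_surj (qrepr y); exists p; rewrite -yp qreprK.
exists (fun y => qclass I (g y)); split.
- exists (fun q => qclass L (Psi (qrepr q))) => [y|q].
    by rewrite [RHS]gP; apply/PsiE; rewrite qreprK.
  by rewrite -[RHS]qreprK; apply/PsiE; rewrite -gP.
- move=> c u v /=; transitivity (qclass I (c *: g u + g v)).
    by apply/PsiE; rewrite -gP PsiL qclassD qclassZ -!gP.
  by rewrite qclassD qclassZ.
case: PsiM => Psi1 PsiM; split=> [|u v] /=.
  by apply/PsiE; rewrite -gP Psi1.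
transitivity (qclass I (g u * g v)); last by rewrite qclassM.
by apply/PsiE; rewrite -gP PsiM qclassM -!gP.
Qed.

(** * Evaluation homomorphisms *)

HB.instance Definition _ (k : fieldType) (B : comAlgType k) n (x : 'I_n -> B) :=
  GRing.RMorphism.copy (alg_eval x) (mmap (in_alg B) x).

Lemma alg_eval_scalable (k : fieldType) (B : comAlgType k) n (x : 'I_n -> B) :
  scalable (alg_eval x).
Proof. by move=> c p; rewrite /alg_eval mmapZ /= mulr_algl. Qed.

HB.instance Definition _ (k : fieldType) (B : comAlgType k) n (x : 'I_n -> B) :=
  GRing.isScalable.Build k {mpoly k[n]} B *:%R (alg_eval x)
    (alg_eval_scalable x).

Lemma alg_evalX (k : fieldType) (B : comAlgType k) n (x : 'I_n -> B) i : alg_eval x 'X_i = x i.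
Proof. by rewrite /alg_eval mmapX mmap1U. Qed.

Lemma alg_evalXm (k : fieldType) (B : comAlgType k) n (x : 'I_n -> B) mu :
  alg_eval x 'X_[mu] = \prod_i x i ^+ mu i.
Proof. by rewrite /alg_eval mmapX. Qed.

Lemma alg_evalE (k : fieldType) (B : comAlgType k) n (x : 'I_n -> B) p :
  alg_eval x p = \sum_(mu <- msupp p) p@_mu *: \prod_i x i ^+ mu i.
Proof.
by rewrite {1}/alg_eval; apply: eq_bigr => mu _; rewrite /= mulr_algl.
Qed.

Lemma alg_eval_mmap (k : fieldType) (B : comAlgType k) n n' (x : 'I_n -> B) (q : 'I_n' -> {mpoly k[n]})
    (p : {mpoly k[n']}) :
  alg_eval x (alg_eval q p) = alg_eval (fun i => alg_eval x (q i)) p.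
Proof.
rewrite (alg_evalE q p) [RHS]alg_evalE linear_sum.
apply: eq_bigr => mu _.
rewrite linearZ rmorph_prod; congr (_ *: _).
by apply: eq_bigr => i _; rewrite rmorphXn.
Qed.

Lemma eq_alg_eval (k : fieldType) (B : comAlgType k) n (x y : 'I_n -> B) : x =1 y -> alg_eval x =1 alg_eval y.
Proof.
move=> xy p; rewrite !alg_evalE; apply: eq_bigr => mu _; congr (_ *: _).
by apply: eq_bigr => i _; rewrite xy.
Qed.

(** The class modulo [J] respects sums, products and scalars, so it depends only on the classes of
    the evaluation points. *)
Lemma alg_eval_congr (k : fieldType) (B : comAlgType k) n (J : ideal B) (x y : 'I_n -> B) :
  (forall i, x i - y i \in J) ->
  forall p, alg_eval x p - alg_eval y p \in J.
Proof.
move=> xy p; apply/qclassP; rewrite !alg_evalE.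
have qX (u v : B) e : qclass J u = qclass J v -> qclass J (u ^+ e) = qclass J (v ^+ e).
  by move=> uv; elim: e => // e IH; rewrite !exprS; apply: qclassM_eq.
elim/big_ind2: _ => // [u u' v v' uu' vv'|mu _]; first by rewrite !qclassD uu' vv'.
rewrite !qclassZ; congr (qscale _ _); elim/big_ind2: _ => // [u u' v v'|i _].
  exact: qclassM_eq.
by apply: qX; apply/qclassP.
Qed.

Lemma alg_eval_id (k : fieldType) n (p : {mpoly k[n]}) :
  alg_eval (fun i => 'X_i) p = p.
Proof.
by rewrite alg_evalE [RHS]mpolyE; apply: eq_bigr => mu _; rewrite -mpolyXE_id.
Qed.

(** * Weighted homogeneous components *)

Section Components.
Variables (k : fieldType) (N : nat) (w : 'I_N -> nat).
Implicit Types p q : {mpoly k[N]}.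

Definition wcomponent i p : {mpoly k[N]} :=
  \sum_(mu <- msupp p | mweightw w mu == i) p@_mu *: 'X_[mu].

Definition wbounded i p := forall mu, mu \in msupp p -> (mweightw w mu <= i)%N.

Lemma mcoeff_wcomponent i p mu :
  (wcomponent i p)@_mu = if mweightw w mu == i then p@_mu else 0.
Proof.
rewrite raddf_sum /= (eq_bigr (fun nu => (p@_nu *: 'X_[nu])@_mu)) //.
rewrite -big_filter.
have [pmu|pmu] := boolP (mu \in msupp p); last first.
  rewrite (memN_msupp_eq0 pmu) if_same big_seq big1 // => nu.
  rewrite mem_filter => /andP[_ pnu]; rewrite mcoeffZ mcoeffX.
  have [E|_] := eqVneq nu mu; last by rewrite mulr0.
    by rewrite -E pnu in pmu.
have [wmu|wmu] := ifPn.
  rewrite (bigD1_seq mu) ?filter_uniq ?msupp_uniq ?mem_filter ?wmu //=.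
  rewrite mcoeffZ mcoeffX eqxx mulr1 big1 ?addr0 // => nu ne.
  by rewrite mcoeffZ mcoeffX (negPf ne) mulr0.
rewrite big_seq big1 // => nu.
rewrite mem_filter => /andP[wnu _]; rewrite mcoeffZ mcoeffX.
have [E|_] := eqVneq nu mu; last by rewrite mulr0.
by rewrite -E wnu in wmu.
Qed.

Lemma wcomponentB i : {morph wcomponent i : p q / p - q}.
Proof.
move=> p q; apply/mpolyP => mu; rewrite mcoeffB !mcoeff_wcomponent mcoeffB.
by case: ifP => // _; rewrite subr0.
Qed.

HB.instance Definition _ i := GRing.isZmodMorphism.Build
  {mpoly k[N]} {mpoly k[N]} (wcomponent i) (wcomponentB i).

Lemma wcomponent_id i p : wcomponent i (wcomponent i p) = wcomponent i p.
Proof.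
by apply/mpolyP => mu; rewrite !mcoeff_wcomponent; case: (_ == i).
Qed.

Lemma wcomponent_neq i j p : i != j -> wcomponent j (wcomponent i p) = 0.
Proof.
move=> ne; apply/mpolyP => mu; rewrite !mcoeff_wcomponent mcoeff0.
by case: eqP => // ->; rewrite eq_sym (negPf ne).
Qed.

Lemma wcomponent_gt i j p : wbounded i p -> (i < j)%N -> wcomponent j p = 0.
Proof.
move=> ip lt_ij; apply/mpolyP => mu; rewrite mcoeff_wcomponent mcoeff0.
case: eqP => // wj; apply: memN_msupp_eq0; apply/negP => /ip.
by rewrite wj leqNgt lt_ij.
Qed.

Lemma wbounded_wcomponent i p : wbounded i (wcomponent i p).
Proof.
move=> mu; rewrite mcoeff_msupp mcoeff_wcomponent.
by case: ifP => [/eqP->|]; rewrite ?eqxx.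
Qed.

Lemma wbounded_le i j p : (i <= j)%N -> wbounded i p -> wbounded j p.
Proof. by move=> ij ip mu /ip wmu; apply: leq_trans wmu ij. Qed.

Lemma wcomponent_sum i p : wbounded i p -> p = \sum_(j < i.+1) wcomponent j p.
Proof.
move=> ip; apply/mpolyP => mu; rewrite raddf_sum /=.
under eq_bigr do rewrite mcoeff_wcomponent.
have [/ip wmu|pmu] := boolP (mu \in msupp p); last first.
  by rewrite (memN_msupp_eq0 pmu) big1 // => j _; rewrite if_same.
rewrite (bigD1 (Ordinal (wmu : mweightw w mu < i.+1)%N)) //= eqxx.
rewrite big1 ?addr0 // => j ne; case: eqP => // wj; case/eqP: ne.
exact: val_inj.
Qed.

Lemma wboundedD i p q : wbounded i p -> wbounded i q -> wbounded i (p + q).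
Proof.
move=> ip iq mu /msuppD_le; rewrite mem_cat => /orP[/ip|/iq] //.
Qed.

Lemma wboundedB i p q : wbounded i p -> wbounded i q -> wbounded i (p - q).
Proof.
by move=> ip iq; apply: wboundedD => // mu; rewrite (perm_mem (msuppN _)); apply: iq.
Qed.

Lemma wboundedM i j p q : wbounded i p -> wbounded j q ->
  wbounded (i + j) (p * q).
Proof.
move=> ip jq mu /msuppM_le/allpairsP[[mu1 mu2] /= [/ip w1 /jq w2 ->]].
rewrite /mweightw (eq_bigr (fun l => w l * mu1 l + w l * mu2 l)%N).
  by rewrite big_split leq_add.
by move=> l _; rewrite mnmDE mulnDr.
Qed.

Lemma wbounded1 : wbounded 0 1.
Proof.
move=> mu; rewrite msupp1 inE => /eqP ->.
by rewrite /mweightw big1 // => l _; rewrite mnm0E muln0.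
Qed.

Lemma wboundedX l : wbounded (w l) 'X_l.
Proof.
move=> mu; rewrite msuppX inE => /eqP ->.
rewrite /mweightw (bigD1 l) //= mnm1E eqxx muln1 big1 ?addn0 // => j ne.
by rewrite mnm1E eq_sym (negPf ne) muln0.
Qed.

Lemma wboundedXn e i p : wbounded i p -> wbounded (i * e) (p ^+ e).
Proof.
move=> ip; elim: e => [|e IH]; first by rewrite muln0; apply: wbounded1.
by rewrite exprS mulnS; apply: wboundedM.
Qed.

Lemma wbounded_prod (T : Type) (l : seq T) (i : T -> nat) (p : T -> {mpoly k[N]}) :
  (forall t, wbounded (i t) (p t)) ->
  wbounded (\sum_(t <- l) i t) (\prod_(t <- l) p t).
Proof.
move=> ip; elim: l => [|t l IH]; first by rewrite !big_nil; apply: wbounded1.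
by rewrite !big_cons; apply: wboundedM.
Qed.

Lemma wbounded0 i : wbounded i 0.
Proof. by move=> mu; rewrite msupp0. Qed.

Lemma wboundedZ i c p : wbounded i p -> wbounded i (c *: p).
Proof. by move=> ip mu /msuppZ_le; apply: ip. Qed.

Lemma wbounded_sum (T : eqType) (l : seq T) i (p : T -> {mpoly k[N]}) :
  (forall t, t \in l -> wbounded i (p t)) -> wbounded i (\sum_(t <- l) p t).
Proof.
move=> ip; rewrite big_seq; elim/big_ind: _ => //; first exact: wbounded0.
by move=> *; apply: wboundedD.
Qed.

(** Serves the coefficients taken from ker D, which become polynomials in the weight-zero variables
    Z_i. *)
Lemma wbounded_alg_eval0 n (y : 'I_n -> {mpoly k[N]}) (p : {mpoly k[n]}) :
  (forall l, wbounded 0 (y l)) -> wbounded 0 (alg_eval y p).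
Proof.
move=> y0; rewrite alg_evalE; apply: wbounded_sum => mu _; apply: wboundedZ.
have := @wbounded_prod _ (index_enum _) (fun=> 0%N) (fun l => y l ^+ mu l).
rewrite big1 //; apply=> l.
by have := wboundedXn (e := mu l) (y0 l); rewrite mul0n.
Qed.

Lemma wbounded_wdegree p : wbounded (wdegree w p) p.
Proof. by move=> mu pmu; rewrite /wdegree (big_rem mu) //= leq_maxl. Qed.

Lemma top_componentE p : top_component w p = wcomponent (wdegree w p) p.
Proof. by []. Qed.

(** The bound gives weighted degree at most [i], and a nonzero component of weight [i] forces
    equality. *)
Lemma top_component_eq i p :
  wbounded i p -> wcomponent i p != 0 -> top_component w p = wcomponent i p.
Proof.
move=> ip nz; rewrite top_componentE; congr (wcomponent _ _).
apply/eqP; rewrite eqn_leq; apply/andP; split.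
  by rewrite /wdegree big_seq; elim/big_ind: _ => // u v; rewrite geq_max => -> ->.
rewrite leqNgt; apply: contraNN nz => lt.
by rewrite (wcomponent_gt (@wbounded_wdegree p) lt).
Qed.

End Components.

(** * Kernels of iterates and proper filtrations *)

Section Filtration.
Variables (k : fieldType) (B : comAlgType k) (D : lnd B).
Implicit Types (a b c t : B) (G : nat -> B -> Prop).

Lemma lnd_kerM a b : D a = 0 -> D b = 0 -> D (a * b) = 0.
Proof. by move=> Da Db; rewrite lnd_leibniz Da Db mul0r mulr0 addr0. Qed.

Lemma lnd_kerX a i : D a = 0 -> D (a ^+ i) = 0.
Proof.
move=> Da; elim: i => [|i IH]; first exact: lnd1.
by rewrite exprS lnd_kerM.
Qed.

Lemma lnd_iter_kerM i a b : D a = 0 -> iter i D (a * b) = a * iter i D b.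
Proof.
by move=> Da; elim: i => //= i ->; rewrite lnd_leibniz Da mul0r add0r.
Qed.

(** D(t^(i+1)) = (i+1) D(t) t^i, and the factor (i+1) D(t) lies in ker D, so it passes through the
    remaining iterates. *)
Lemma lnd_iter_localsliceX t i : D (D t) = 0 -> iter i D (t ^+ i) = D t ^+ i *+ i`!.
Proof.
move=> DDt; elim: i => // i IH; rewrite iterSr.
have -> : D (t ^+ i.+1) = (D t *+ i.+1) * t ^+ i.
  elim: i {IH} => [|i IH]; first by rewrite expr1 mulr1.
  by rewrite exprS lnd_leibniz IH mulrCA -exprS -mulrDl -mulrS.
have Dt : D (D t *+ i.+1) = 0 by rewrite raddfMn /= DDt mul0rn.
by rewrite (lnd_iter_kerM _ _ Dt) IH mulrnAl mulrnAr -exprS -mulrnA mulnC factS mulnC.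
Qed.

Lemma filtration_le G i j a : nfiltration G -> (i <= j)%N -> G i a -> G j a.
Proof.
move=> [_ GS _ _] /subnK <-; elim: (j - i)%N => // e IH Ga.
by rewrite addSn; apply: GS; apply: IH.
Qed.

Lemma filtration_exp G a i : nfiltration G -> G 0%N 1 -> G 1%N a -> G i (a ^+ i).
Proof.
move=> [_ _ _ GM] G1 Ga; elim: i => // i IH.
by rewrite exprS -add1n; apply: GM.
Qed.

(** A nonzero [c] in [G 0] has exact level 0, so multiplication by [c] preserves exact levels; [a]
    cannot sit at a level above [i] while [c * a] is in [G i]. *)
Lemma proper_filtration_saturated G i a c : proper_nfiltration G ->
  c <> 0 -> G 0%N c -> G i (c * a) -> G i a.
Proof.
move=> [filG prG] nz_c Gc Gca; have [GV GS Gex GM] := filG.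
have [l Gla] := Gex a; elim: l Gla => [|l IH] Gla; first exact: filtration_le Gla.
have [le_li|lt_il] := leqP l.+1 i; first exact: filtration_le Gla.
have [/IH //|nGla] := pselect (G l a).
have [] // : exact_level G (0 + l.+1)%N (c * a) by apply: prG.
by move=> _ []; exact: filtration_le Gca.
Qed.

Lemma proper_filtration_ker G (char0 : [pchar k] =i pred0)
    (domB : GRing.integral_domain_axiom B) :
  proper_nfiltration G ->
  (forall a, D a = 0 -> G 0%N a) -> (forall a, D (D a) = 0 -> G 1%N a) ->
  forall i a, iter i.+1 D a = 0 -> G i a.
Proof.
move=> prG G0 G1; have [filG _] := prG; have [GV GS _ GM] := filG.
have GD i a b : G i a -> G i b -> G i (a + b).
  by have [_ /(_ 1 a b)] := GV i; rewrite scale1r.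
elim=> [|i IH] a Da; first exact: G0.
have [|/eqP Dia] := eqVneq (iter i.+1 D a) 0; first by move/IH/GS.
(* [t] is the iterate just before the one in ker D, hence lies in ker D^2 and, by [G1], in [G 1]. *)
pose t := iter i D a; have DDt : D (D t) = 0 by [].
(* The (i+1)-st iterate of D maps [a] to D(t) and t^(i+1) to (i+1)! D(t)^(i+1); this [c] makes the
   images of [c * a] and t^(i+1) agree. *)
pose c := D t ^+ i *+ (i.+1)`!.
have Dc : D c = 0 by rewrite /c raddfMn /= lnd_kerX ?mul0rn.
have nz_c : c <> 0.
  move/eqP; rewrite /c -scaler_nat scaler_eq0 => /orP[|].
    by move/pcharf0P: char0 => ->; rewrite -leqn0 leqNgt fact_gt0.
  have {}Dia : D t != 0 by apply/eqP.
  elim: (i) => [|j IHj]; first by rewrite oner_eq0.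
  by rewrite exprS => /eqP/domB; rewrite (negPf Dia).
have cE : iter i.+1 D (c * a - t ^+ i.+1) = 0.
  rewrite lnd_iterB (lnd_iter_kerM _ _ Dc) lnd_iter_localsliceX //.
  by rewrite /c mulrnAl -exprSr subrr.
apply: (proper_filtration_saturated prG nz_c); first exact: G0.
rewrite -(subrK (t ^+ i.+1) (c * a)); apply: (GD); first exact/GS/IH.
by apply: filtration_exp => //; [apply: G0; apply: lnd1 | apply: G1].
Qed.
End Filtration.

(** * Presentation of the associated graded algebra by highest components *)

Lemma ideal_spanP (R : comPzRingType) (S : R -> Prop) a :
  reflect (in_span S a) (a \in ideal_span S).
Proof. exact: asboolP. Qed.

Lemma mem_ideal_span (R : comPzRingType) (S : R -> Prop) a :
  S a -> a \in ideal_span S.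
Proof.
move=> Sa; apply/ideal_spanP; exists [:: (1, a)].
by split=> [t|]; rewrite ?inE ?big_seq1 ?mul1r // => /eqP ->.
Qed.

Section GradedPresentation.
Variables (k : fieldType) (B : comAlgType k) (D : lnd B) (N : nat).
Variables (w : 'I_N -> nat) (y : 'I_N -> B).
Hypothesis deg_y : forall l, iter (w l).+1 D (y l) = 0.
Variable J : ideal {mpoly k[N]}.
Hypothesis kerJ : forall p, p \in J <-> alg_eval y p = 0.
Hypothesis full : forall i a, iter i.+1 D a = 0 ->
  exists q, wbounded w i q /\ a = alg_eval y q.

Local Notation E := (alg_eval y).

(** [fam D] is the Rees algebra of the filtration: each variable goes to its value times T^w, its
    weight w being an admissible degree by [deg_y]. *)
Definition fam_eval : {mpoly k[N]} -> fam D :=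
  alg_eval (fun l => Fam (gr_class_subproof (deg_y l))).

HB.instance Definition _ := GRing.LRMorphism.copy fam_eval
  (alg_eval (fun l => Fam (gr_class_subproof (deg_y l)))).

(** A monomial of weight j is sent to its value times T^j, so the coefficient of T^i collects
    exactly the terms of weight [i]. *)
Lemma coef_fam_eval q i : (fam_poly (fam_eval q))`_i = E (wcomponent w i q).
Proof.
rewrite /fam_eval alg_evalE (big_morph (@fam_poly _ _ D) (id1 := 0) (op1 := +%R)) //.
rewrite coef_sum /wcomponent raddf_sum /= [RHS]big_mkcond /=; apply: eq_bigr => mu _.
have -> : fam_poly (\prod_l Fam (gr_class_subproof (deg_y l)) ^+ mu l) =
    (\prod_l y l ^+ mu l) *: 'X^(mweightw w mu).
  rewrite (big_morph (@fam_poly _ _ D) (id1 := 1) (op1 := *%R)) //.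
  rewrite -mul_polyC /mweightw rmorph_prod -prodrXr -big_split.
  apply: eq_bigr => l _ /=.
  rewrite (_ : fam_poly _ = (y l *: 'X^(w l)) ^+ mu l).
    by rewrite -mul_polyC exprMn rmorphXn -exprM.
  by elim: (mu l) => // e IH; rewrite !exprS -IH.
rewrite coefCM mulr_algl coefZ coefXn eq_sym.
case: ifP => _; last by rewrite mulr0 scaler0.
by rewrite mulr1 linearZ /= alg_evalXm.
Qed.

Lemma lnd_iter_sum i (T : Type) (l : seq T) (P : pred T) (F : T -> B) :
  (forall t, P t -> iter i D (F t) = 0) -> iter i D (\sum_(t <- l | P t) F t) = 0.
Proof.
move=> F0; elim/big_ind: _ => //; first exact: lnd_iter0.
by move=> a b Da Db; rewrite lnd_iterD Da Db addr0.
Qed.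

Lemma lnd_iter_wcomponent q i : iter i.+1 D (E (wcomponent w i q)) = 0.
Proof. by rewrite -coef_fam_eval; apply/fam_predP/fam_polyP. Qed.

(** Components of weight less than [i] take values in F_(i-1), so only the component of weight [i]
    matters there. *)
Lemma lnd_iter_tail q i : wbounded w i q ->
  iter i D (E q - E (wcomponent w i q)) = 0.
Proof.
move=> /wcomponent_sum {1}->; rewrite big_ord_recr /= rmorphD addrK rmorph_sum.
apply: lnd_iter_sum => j _.
exact: lnd_iter_le (ltn_ord j) (lnd_iter_wcomponent _ _).
Qed.

(** Written so that [hatJ] unfolds to it for the weights [omega d]. *)
Definition initial_ideal : ideal {mpoly k[N]} :=
  ideal_span (fun q => exists2 p, p \in J & q = top_component w p).

(** As [p] evaluates to 0, the value of its top component is minus that of its terms of lower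
    weight, hence of lower degree. *)
Lemma fam_eval_top p : p \in J -> fam_eval (top_component w p) \in low_ideal D.
Proof.
move=> Jp; apply/low_predP => i; rewrite coef_fam_eval top_componentE.
have [<-|ne] := eqVneq (wdegree w p) i; last first.
  by rewrite wcomponent_neq // rmorph0 lnd_iter0.
rewrite wcomponent_id.
have := lnd_iter_tail (@wbounded_wdegree _ _ w p).
by rewrite ((kerJ p).1 Jp) lnd_iterB lnd_iter0 sub0r => /eqP; rewrite oppr_eq0 => /eqP.
Qed.

(** By [full], the value of the component q is also that of some h of weight less than [i]; then q -
    h is in [J] and has q as its highest component. *)
Lemma wcomponent_initial p i :
  iter i D (E (wcomponent w i p)) = 0 -> wcomponent w i p \in initial_ideal.
Proof.
set q := wcomponent w i p => Dq.
have [->|nz_q] := eqVneq q 0; first exact: rpred0.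
have [h [hi h0 Eqh]] : exists h,
    [/\ wbounded w i h, wcomponent w i h = 0 & E q = E h].
  case: i @q Dq nz_q => [|i] q Dq nz_q.
    (* For weight 0 the hypothesis already says that the value is 0, in accordance with F_(-1) =
       0. *)
    exists 0; split; [exact: wbounded0 | exact: raddf0 | by rewrite rmorph0].
  have [h [hi Eqh]] := full Dq; exists h; split=> //.
    exact: wbounded_le hi.
  exact: wcomponent_gt hi _.
have qh : wcomponent w i (q - h) = q by rewrite wcomponentB h0 subr0 wcomponent_id.
apply: mem_ideal_span; exists (q - h); last first.
  rewrite (@top_component_eq _ _ w i) ?qh //.
  by apply: wboundedB => //; apply: wbounded_wcomponent.
by apply/kerJ; rewrite rmorphB /= Eqh subrr.
Qed.

(** Membership in [low_ideal] is tested on each coefficient, and these are the values of the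
    components of [p]; so the converse can be proved one component at a time. *)
Lemma fam_eval_ker p : p \in initial_ideal <-> fam_eval p \in low_ideal D.
Proof.
split=> [/ideal_spanP[l [Jl ->]]|/low_predP low_p].
  rewrite rmorph_sum big_seq; apply: rpred_sum => t /Jl[u Ju ->].
  by rewrite rmorphM; apply: ideal_absorb; apply: fam_eval_top.
rewrite (wcomponent_sum (@wbounded_wdegree _ _ w p)); apply: rpred_sum => i _.
by apply: wcomponent_initial; rewrite -coef_fam_eval.
Qed.

Lemma fam_eval_surj (p : fam D) : exists q, p - fam_eval q \in low_ideal D.
Proof.
have /fam_predP Fp := fam_polyP p.
have /choice[q qP] i := full (Fp i).
(* Only the part of [q i] of weight [i] is kept: it affects the coefficient of index [i] alone, and
   what is dropped has its value in F_(i-1). *)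
exists (\sum_(i < size (fam_poly p)) wcomponent w i (q i)).
apply/low_predP => i; rewrite coefB coef_fam_eval [wcomponent w i _]raddf_sum /=.
have [lt_i|le_i] := ltnP i (size (fam_poly p)); last first.
  rewrite nth_default // big1 ?rmorph0 ?subr0 ?lnd_iter0 // => j _.
  by rewrite wcomponent_neq // neq_ltn (leq_trans (ltn_ord j)).
rewrite (bigD1 (Ordinal lt_i)) //= big1 ?addr0 => [|j ne].
  by have [qi ->] := qP i; rewrite wcomponent_id; apply: lnd_iter_tail.
by rewrite wcomponent_neq.
Qed.

Lemma gr_presentation : exists f : gr_alg D -> quot_alg initial_ideal,
  [/\ bijective f, linear f & monoid_morphism f].
Proof.
apply: (quot_iso (Psi := fam_eval)).
- by split; [apply: rmorph1 | apply: rmorphM].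
- exact: linearP.
- exact: fam_eval_surj.
- exact: fam_eval_ker.
Qed.

End GradedPresentation.

(** * Elimination of the variables Z and S *)

Section Elimination.
Variables (k : fieldType) (r n m : nat).
Variables (z : 'I_r -> {mpoly k[n]}) (s : 'I_m -> {mpoly k[n]}).
Variable (I : ideal {mpoly k[n]}).

(** Evaluation at these polynomials is a left inverse of [inX]; it reduces membership in [idealJ] to
    membership in [I]. *)
Definition elim_var (i : 'I_(r + n + m)) : {mpoly k[n]} :=
  match split i with
  | inl j => match split j with inl a => z a | inr b => 'X_b end
  | inr c => s c
  end.

Lemma elim_varZ i : elim_var (lshift m (lshift n i)) = z i.
Proof. by rewrite /elim_var !(unsplitK (inl _)). Qed.

Lemma elim_varX i : elim_var (lshift m (rshift r i)) = 'X_i.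
Proof. by rewrite /elim_var (unsplitK (inl _)) (unsplitK (inr _)). Qed.

Lemma elim_varS i : elim_var (rshift (r + n) i) = s i.
Proof. by rewrite /elim_var (unsplitK (inr _)). Qed.

Lemma omega_varZ d i : omega d (lshift m (lshift n i) : 'I_(r + n + m)) = 0%N.
Proof. by rewrite /omega !(unsplitK (inl _)). Qed.

Lemma omega_varX d i : omega d (lshift m (rshift r i) : 'I_(r + n + m)) = d i.
Proof. by rewrite /omega (unsplitK (inl _)) (unsplitK (inr _)). Qed.

Lemma omega_varS d i : omega d (rshift (r + n) i : 'I_(r + n + m)) = 1%N.
Proof. by rewrite /omega (unsplitK (inr _)). Qed.

Lemma inXE p : inX r m p = alg_eval (@varX k r n m) p.
Proof.
rewrite alg_evalE /inX comp_mpolyE; apply: eq_bigr => mu _; congr (_ *: _).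
by apply: eq_bigr => i _; rewrite tnth_mktuple.
Qed.

(** The generators of [idealJ] make each variable congruent to its substitute, and congruence
    extends from variables to all polynomials. *)
Lemma idealJ_elim q : q - inX r m (alg_eval elim_var q) \in idealJ I z s.
Proof.
(* [q] is read as its own evaluation at the variables, to compare two evaluations of the same
   polynomial. *)
rewrite inXE alg_eval_mmap -{1}[q]alg_eval_id.
apply: alg_eval_congr => i; rewrite -inXE.
rewrite -(splitK i) /unsplit; case: (split i) => [j|c].
  rewrite -(splitK j) /unsplit; case: (split j) => [a|b].
    by rewrite elim_varZ; apply: mem_ideal_span; apply: Or32; exists a.
  by rewrite elim_varX inXE alg_evalX subrr rpred0.
by rewrite elim_varS; apply: mem_ideal_span; apply: Or33; exists c.
Qed.

(** The generators vanish under evaluation. Conversely, if [q] evaluates to 0, its elimination lies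
    in [I], and [q] differs from that elimination by an element of [idealJ]. *)
Lemma idealJ_ker (B : comAlgType k) (x : 'I_n -> B) :
  (forall p, p \in I <-> alg_eval x p = 0) ->
  forall q, q \in idealJ I z s <-> alg_eval (fun i => alg_eval x (elim_var i)) q = 0.
Proof.
move=> kerI.
have evalX p : alg_eval (fun i => alg_eval x (elim_var i)) (inX r m p) = alg_eval x p.
  rewrite inXE alg_eval_mmap; apply: eq_alg_eval => i.
  by rewrite alg_evalX elim_varX alg_evalX.
move=> q; split=> [/ideal_spanP[l [Jl ->]]|].
  rewrite rmorph_sum big_seq big1 // => t /Jl Jt; rewrite rmorphM /=.
  suff -> : alg_eval (fun i => alg_eval x (elim_var i)) t.2 = 0 by rewrite mulr0.
  case: Jt => [[p /kerI xp ->]|[i ->]|[i ->]]; first by rewrite evalX.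
  - by rewrite rmorphB /= evalX alg_evalX elim_varZ subrr.
  - by rewrite rmorphB /= evalX alg_evalX elim_varS subrr.
rewrite -alg_eval_mmap => /kerI Iq.
rewrite -(subrK (inX r m (alg_eval elim_var q)) q); apply: rpredD.
  exact: idealJ_elim.
by apply: mem_ideal_span; apply: Or31; exists (alg_eval elim_var q).
Qed.

End Elimination.

(** * The filtration generated by the s_j and x_i *)

(** A coefficient in ker D lifts to a polynomial in the Z_i, of weight 0, while s_j and x_i lift to
    S_j and X_i of weights 1 and d_i; the bound on exponents is then the bound on weights. *)
Lemma gen_filtration_wbounded (k : fieldType) (B : comAlgType k) (D : lnd B)
    (r n m : nat) (x : 'I_n -> B) (z : 'I_r -> {mpoly k[n]})
    (s : 'I_m -> {mpoly k[n]}) (d : 'I_n -> nat) :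
  (forall a, D a = 0 ->
     exists p : {mpoly k[r]}, a = alg_eval (fun i => alg_eval x (z i)) p) ->
  forall i a, gen_filtration D (fun j => alg_eval x (s j)) x d i a ->
  exists q : {mpoly k[r + n + m]}, wbounded (omega d) i q /\
    a = alg_eval (fun l => alg_eval x (elim_var z s l)) q.
Proof.
move=> kerD i a [l [lP ->]]; rewrite big_seq.
elim/big_ind: _ => [|_ _ [p [ip ->]] [q [iq ->]]|[c [u v]] /lP /= [Dc le_i]].
- by exists 0; rewrite rmorph0; split=> //; apply: wbounded0.
- by exists (p + q); rewrite rmorphD; split=> //; apply: wboundedD.
have [p ->] := kerD _ Dc.
exists (alg_eval (@varZ k r n m) p * (\prod_(e < m) varS k r n e ^+ u e)
  * (\prod_(e < n) varX k r m e ^+ v e)); split.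
  apply: wbounded_le le_i _; apply: wboundedM; first rewrite -[X in wbounded _ X]add0n.
    apply: wboundedM.
      apply: wbounded_alg_eval0 => j.
      by rewrite -(omega_varZ m d j); apply: wboundedX.
    apply: wbounded_prod => e; rewrite -[X in wbounded _ X]mul1n.
    by rewrite -[X in (X * _)%N](omega_varS r d e); apply: wboundedXn; apply: wboundedX.
  apply: wbounded_prod => e; rewrite -(omega_varX r m d e).
  by apply: wboundedXn; apply: wboundedX.
rewrite !rmorphM !rmorph_prod /= alg_eval_mmap; congr (_ * _ * _).
- by apply: eq_alg_eval => j; rewrite alg_evalX elim_varZ.
- by apply: eq_bigr => e _; rewrite rmorphXn /= alg_evalX elim_varS.
- by apply: eq_bigr => e _; rewrite rmorphXn /= alg_evalX elim_varX alg_evalX.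
Qed.

Lemma lnd_deg_iter (k : fieldType) (B : comAlgType k) (D : lnd B) a i :
  lnd_deg D a = Some i -> iter i.+1 D a = 0.
Proof.
rewrite /lnd_deg; case: eqP => // _ [<-].
by case: ex_minnP => j /eqP.
Qed.

Section GenFiltration.
Variables (k : fieldType) (B : comAlgType k) (D : lnd B) (m n : nat).
Variables (s : 'I_m -> B) (x : 'I_n -> B) (d : 'I_n -> nat).
Local Notation G := (gen_filtration D s x d).

Lemma gen_filtration0 a : D a = 0 -> G 0%N a.
Proof.
move=> Da; exists [:: (a, (0%MM, 0%MM))]; split=> [t|].
  rewrite inE => /eqP -> /=; split=> //.
  by rewrite !big1 // => e _; rewrite mnm0E ?muln0.
by rewrite big_seq1 /= !big1 ?mulr1 // => e _; rewrite mnm0E.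
Qed.

Lemma gen_filtration1 i : G 1%N (s i).
Proof.
exists [:: (1, (U_(i)%MM, 0%MM))]; split=> [t|].
  rewrite inE => /eqP -> /=; split; first exact: lnd1.
  rewrite [X in (_ + X)%N]big1 => [|e _]; last by rewrite mnm0E muln0.
  by rewrite (bigD1 i) //= mnm1E eqxx big1 // => e ne; rewrite mnm1E eq_sym (negPf ne).
rewrite big_seq1 /= [X in _ * X]big1 => [|e _]; last by rewrite mnm0E.
rewrite mulr1 mul1r (bigD1 i) //= mnm1E eqxx expr1 big1 ?mulr1 // => e ne.
by rewrite mnm1E eq_sym (negPf ne).
Qed.

(** If D(a) is the sum of the c_i D(s_i) with c_i in ker D, then [a] minus the sum of the c_i s_i is
    in ker D, which lies in [G 0]. *)
Lemma gen_filtration_ker2 :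
  nfiltration G ->
  (forall a, plinth D a -> exists c : 'I_m -> B, (forall i, D (c i) = 0) /\
     a = \sum_i c i * D (s i)) ->
  forall a, D (D a) = 0 -> G 1%N a.
Proof.
move=> [GV GS _ GM] plD a DDa.
have /plD[c [Dc Da]] : plinth D (D a) by split=> //; exists a.
have [G1_0 G1V] := GV 1%N.
have GD u v : G 1%N u -> G 1%N v -> G 1%N (u + v).
  by move=> Gu Gv; rewrite -[u]scale1r; apply: G1V.
rewrite -(subrK (\sum_i c i * s i) a); apply: (GD).
  apply: GS; apply: gen_filtration0; rewrite raddfB raddf_sum /= Da.
  rewrite (eq_bigr (fun i => D (c i * s i))) ?subrr // => i _.
  by rewrite lnd_leibniz Dc mul0r add0r.
apply: big_ind => [//|u v|i _]; first exact: GD.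
exact: GM (gen_filtration0 (Dc i)) (gen_filtration1 i).
Qed.

End GenFiltration.

(** * The isomorphism *)

Theorem proposition2p5
  (k : fieldType) (char0 : [pchar k] =i pred0)
  (n : nat) (B : comAlgType k) (domB : GRing.integral_domain_axiom B)
  (I : ideal {mpoly k[n]}) (x : 'I_n -> B)
  (x_generates : forall b : B, exists p : {mpoly k[n]}, b = alg_eval x p)
  (x_relations : forall p : {mpoly k[n]}, p \in I <-> alg_eval x p = 0)
  (I_sub : forall p : {mpoly k[n]}, p \in I ->
     p \in ideal_span (fun q : {mpoly k[n]} => exists i, q = 'X_i))
  (D : lnd B)
  (r : nat) (z : 'I_r -> {mpoly k[n]})
  (z_at0 : forall i, (z i).@[fun=> 0] = 0)
  (z_generates : forall a : B, D a = 0 <->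
     exists p : {mpoly k[r]}, a = alg_eval (fun i => alg_eval x (z i)) p)
  (m : nat) (s : 'I_m -> {mpoly k[n]})
  (s_at0 : forall i, (s i).@[fun=> 0] = 0)
  (s_ker2 : forall i, D (D (alg_eval x (s i))) = 0)
  (s_plinth : forall a : B, plinth D a <->
     exists c : 'I_m -> B, (forall i, D (c i) = 0) /\
       a = \sum_i c i * D (alg_eval x (s i)))
  (d : 'I_n -> nat)
  (x_neq0 : forall i, x i <> 0)
  (d_deg : forall i, lnd_deg D (x i) = Some (d i))
  (G_proper : proper_nfiltration
     (gen_filtration D (fun i => alg_eval x (s i)) x d)) :
  exists f : gr_alg D -> quot_alg (hatJ I z s d),
    [/\ bijective f, linear f & monoid_morphism f].
Proof.
have filt := gen_filtration_ker2 G_proper.1 (fun a => (s_plinth a).1).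
have full := proper_filtration_ker char0 domB G_proper
  (@gen_filtration0 _ _ _ _ _ _ _ _) filt.
have deg_y l : iter (omega d l).+1 D (alg_eval x (elim_var z s l)) = 0.
  rewrite -(splitK l) /unsplit; case: (split l) => [j|c].
    rewrite -(splitK j) /unsplit; case: (split j) => [a|b].
      (* The values of the z_i lie in ker D, being polynomials in the generators. *)
      rewrite elim_varZ omega_varZ; apply/z_generates.
      by exists 'X_a; rewrite alg_evalX.
    by rewrite elim_varX omega_varX alg_evalX; apply: lnd_deg_iter.
  by rewrite elim_varS omega_varS; apply: s_ker2.
(* It remains to lift an element of ker D^(i+1) to weight at most [i]: [full] places it in the
   filtration, whose elements lift. *)
apply: (gr_presentation deg_y (idealJ_ker z s x_relations)) => i a /full.
by apply: gen_filtration_wbounded => b /z_generates.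
Qed.
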